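(* Let $(X,d)$ be a metric space. (i) If $A\subset X$ and $d_A$ is the subspace metric then $C(A,d_A)\leq C(X,d)$ and $C_0(A,d_A)\leq C_0(X,d)$. (ii) If $\lambda>0$ then $C(X,\lambda d)=C(X,d)$ and $C_0(X,\lambda d)=C_0(X,d)$. (iii) $C(X,d)\leq C_0(X,d)\leq 2$. (iv) If $(X,d)$ is unbounded then $1\leq C(X,d)$. (v) If $(X,d)$ is bounded then $C(X,d)=0$. (vi) If $(X,d)$ has at least two distinct points then $C_0(X,d)\geq 1$. (vii) If $(X',d')$ is a metric completion of $(X,d)$ then $C(X,d)=C(X',d')$ and $C_0(X,d)=C_0(X',d')$.
   Context: For a metric space $(X,d)$ and $\mu,\delta \geq 0$, say that $(X,d)$ satisfies the $(\mu,\delta)$-four-point inequality if for all $x,y,z,w\in X$, $d(x,y)+d(z,w)\le \mu\max\{d(x,z)+d(y,w),\ d(x,w)+d(y,z)\}+2\delta$. The quasi-hyperbolicity constant of $(X,d)$ is $C(X,d)=\inf\{\mu\geq 0\mid \text{there exists }\delta\geq 0\text{ such that }(X,d)\text{ satisfies the }(\mu,\delta)\text{-four-point inequality}\}$, and the quadrilateral constant is $C_0(X,d)=\inf\{\mu\geq 0 \mid (X,d)\text{ satisfies the }(\mu,0)\text{-four-point inequality}\}$. *)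

(* Defs.v *)
From HB Require Import structures.
From mathcomp Require Import all_boot all_order all_algebra.
From mathcomp Require Import all_classical all_reals topology.

Set Implicit Arguments.
Unset Strict Implicit.
Unset Printing Implicit Defensive.

Import Order.TTheory GRing.Theory Num.Theory.

Local Open Scope classical_set_scope.
Local Open Scope ring_scope.

(* The pair (T, d) is passed explicitly, rather than as a metricType, so that
   the constants can be compared for several distances on one carrier. *)
Definition four_point_ineq (R : realType) (T : Type) (d : T -> T -> R)
    (mu delta : R) : Prop :=
  forall x y z w : T,
    d x y + d z w <=
      mu * Num.max (d x z + d y w) (d x w + d y z) + 2 * delta.

(* inf is real-valued, with junk value 0 on sets that are empty or not bounded
   below; both sets below are bounded below by 0, and contain 2 as soon as d is
   a metric. *)
Definition quasi_hyp_const (R : realType) (T : Type) (d : T -> T -> R) : R :=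
  inf [set mu | 0 <= mu /\ exists delta, 0 <= delta /\ four_point_ineq d mu delta].

Definition quadrilateral_const (R : realType) (T : Type) (d : T -> T -> R) : R :=
  inf [set mu | 0 <= mu /\ four_point_ineq d mu 0].

Definition subspace_dist (R : realType) (X : metricType R) (A : set X) :
  A -> A -> R := fun a b => mdist (val a) (val b).

Definition scaled_dist (R : realType) (X : metricType R) (lambda : R) :
  X -> X -> R := fun x y => lambda * mdist x y.

Definition bounded_space (R : realType) (X : metricType R) : Prop :=
  exists M : R, forall x y : X, mdist x y <= M.

(* The property of completeType, without its requirement that the space be
   pointed: the completion of the empty space is empty. *)
Definition complete_space (T : uniformType) : Prop :=
  forall F : set_system T, ProperFilter F -> cauchy F -> exists l : T, F --> l.

Definition is_completion (R : realType) (X X' : metricType R) (iota : X -> X')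
    : Prop :=
  [/\ complete_space X',
      forall x y : X, mdist (iota x) (iota y) = mdist x y
    & dense (range iota)].

(* Main.v *)
Require Import Defs.
From HB Require Import structures.
From mathcomp Require Import all_boot all_order all_algebra.
From mathcomp Require Import all_classical all_reals topology.
From mathcomp Require Import lra ring.

(** Both constants are infima of sets of multipliers [mu], so a comparison of
    constants is an inclusion of such sets; the triangle inequality puts [2] in
    every one of them, which makes the infima genuine.

    - A map scaling distances by [lambda > 0] pulls a [(mu, delta)]-inequality
      back to a [(mu, delta / lambda)]-inequality
      ([four_point_ineq_pullback]). The multiplier is unchanged and [delta = 0]
      stays [0], so the constants of the source are at most those of the target.
      This gives monotonicity under subspaces, and scale invariance when
      applied to the identity in both directions.
    - The degenerate quadruple [(x, y, x, y)] shows that a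
      [(mu, delta)]-inequality forces [(1 - mu) * d x y <= delta]
      ([four_point_ineq_dist]). Hence [mu < 1] bounds the diameter, and for
      [delta = 0] it forces the diameter to vanish.
    - If the diameter is at most [M], then [mu = 0] works with [delta = M].
    - Both sides of the inequality are continuous in the four points, so it
      passes from a dense subspace to the whole space with the same [mu] and
      [delta] ([four_point_ineq_dense]); with the pullback along the isometry
      this gives equality of the constants for a completion. *)

Set Implicit Arguments.
Unset Strict Implicit.
Unset Printing Implicit Defensive.

Import Order.TTheory GRing.Theory Num.Theory.

Local Open Scope classical_set_scope.
Local Open Scope ring_scope.

(** Nonemptiness of [B] matters because the infimum of the empty set is [0]
    by convention. *)
Lemma le_inf_subset (R : realType) (A B : set R) :
  has_lbound A -> B !=set0 -> B `<=` A -> inf A <= inf B.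
Proof.
by move=> lbA B0 BA; apply: lb_le_inf => // x Bx; apply: ge_inf => //; apply: BA.
Qed.

Lemma has_lbound_quasi_hyp (R : realType) (T : Type) (d : T -> T -> R) :
  has_lbound
    [set mu | 0 <= mu /\ exists delta, 0 <= delta /\ four_point_ineq d mu delta].
Proof. by exists 0 => mu []. Qed.

Lemma has_lbound_quadrilateral (R : realType) (T : Type) (d : T -> T -> R) :
  has_lbound [set mu | 0 <= mu /\ four_point_ineq d mu 0].
Proof. by exists 0 => mu []. Qed.

(** The sides [d x y] and [d z w] are each bounded in two ways by the triangle
    inequality; adding the four bounds gives
    [2 * (d x y + d z w) <= 2 * (S1 + S2)], where [S1] and [S2] are the two sums
    under the maximum. *)
Lemma four_point_ineq_metric2 (R : realType) (X : metricType R) :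
  four_point_ineq (@mdist R X) 2 0.
Proof.
move=> x y z w.
have := metric_triangle x z y; have := metric_triangle x w y.
have := metric_triangle z x w; have := metric_triangle z y w.
rewrite (metric_sym z y) (metric_sym w y) (metric_sym z x).
set a := Num.max _ _ => h1 h2 h3 h4.
have ha1 : mdist x z + mdist y w <= a by rewrite le_max lexx.
have ha2 : mdist x w + mdist y z <= a by rewrite le_max lexx orbT.
lra.
Qed.

Lemma four_point_ineq_pullback (R : realType) (S T : Type) (e : S -> S -> R)
    (d : T -> T -> R) (f : S -> T) (lambda mu delta : R) :
  0 < lambda -> (forall x y, d (f x) (f y) = lambda * e x y) ->
  four_point_ineq d mu delta -> four_point_ineq e mu (delta / lambda).
Proof.
move=> l0 df H x y z w; have := H (f x) (f y) (f z) (f w).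
rewrite !df -!mulrDr -maxr_pMr ?(ltW l0)//.
set m := Num.max _ _ => Hm; rewrite -(ler_pM2l l0).
suff -> : lambda * (mu * m + 2 * (delta / lambda)) =
          mu * (lambda * m) + 2 * delta by [].
by field; rewrite gt_eqF.
Qed.

Lemma four_point_ineq_dist (R : realType) (X : metricType R) (mu delta : R) :
  four_point_ineq (@mdist R X) mu delta ->
  forall x y : X, (1 - mu) * mdist x y <= delta.
Proof.
move=> H x y; have := H x y x y.
rewrite !mdistxx addr0 (metric_sym y x) max_r ?addr_ge0 ?mdist_ge0//.
lra.
Qed.

(** Moving each of the four points by less than [eps] changes each sum of two
    distances by at most [4 * eps], so the inequality fails by at most
    [4 * (mu + 1) * eps]. *)
Lemma four_point_ineq_dense (R : realType) (X X' : metricType R)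
    (iota : X -> X') (mu delta : R) :
  (forall x y : X, mdist (iota x) (iota y) = mdist x y) ->
  dense (range iota) -> 0 <= mu ->
  four_point_ineq (@mdist R X) mu delta ->
  four_point_ineq (@mdist R X') mu delta.
Proof.
move=> iso dns mu0 H x' y' z' w'.
have near_image (p : X') (eps : R) : 0 < eps ->
    exists q : X, mdist p (iota q) < eps.
  move=> e0; have [||r [pr [q _ qr]]] := dns (interior (ball p eps)).
  - by exists p; exact: nbhsx_ballx.
  - exact: open_interior.
  - by exists q; have := interior_subset pr; rewrite ballEmdist qr.
apply/ler_addgt0Pr => e e0.
pose eps := e / (4 * (mu + 1)).
have m1 : 0 < 4 * (mu + 1) by lra.
have eps0 : 0 < eps by apply: divr_gt0.
have eE : e = 4 * (mu + 1) * eps by rewrite /eps mulrC divfK// gt_eqF.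
have [x hx] := near_image x' _ eps0; have [y hy] := near_image y' _ eps0.
have [z hz] := near_image z' _ eps0; have [w hw] := near_image w' _ eps0.
have move_up (p' q' : X') (p q : X) : mdist p' (iota p) < eps ->
    mdist q' (iota q) < eps -> mdist p' q' <= mdist p q + 2 * eps.
  move=> hp hq; have := metric_triangle p' (iota p) q'.
  have := metric_triangle (iota p) (iota q) q'.
  by rewrite iso (metric_sym (iota q)); lra.
have move_down (p' q' : X') (p q : X) : mdist p' (iota p) < eps ->
    mdist q' (iota q) < eps -> mdist p q <= mdist p' q' + 2 * eps.
  move=> hp hq; have := metric_triangle (iota p) p' (iota q).
  have := metric_triangle p' q' (iota q).
  by rewrite iso (metric_sym (iota p)); lra.
have hxy := move_up _ _ _ _ hx hy; have hzw := move_up _ _ _ _ hz hw.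
have hxz := move_down _ _ _ _ hx hz; have hyw := move_down _ _ _ _ hy hw.
have hxw := move_down _ _ _ _ hx hw; have hyz := move_down _ _ _ _ hy hz.
have := H x y z w; set a := Num.max _ _; set b := Num.max _ _ => Hab.
have hb1 : mdist x' z' + mdist y' w' <= b by rewrite le_max lexx.
have hb2 : mdist x' w' + mdist y' z' <= b by rewrite le_max lexx orbT.
have hab : a <= b + 4 * eps by rewrite ge_max; apply/andP; split; lra.
have := ler_wpM2l mu0 hab; rewrite eE; lra.
Qed.

Lemma quasi_hyp_const_le (R : realType) (S T : Type) (e : S -> S -> R)
    (d : T -> T -> R) :
  four_point_ineq d 2 0 ->
  (forall mu delta, 0 <= mu -> 0 <= delta -> four_point_ineq d mu delta ->
     exists2 delta', 0 <= delta' & four_point_ineq e mu delta') ->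
  quasi_hyp_const e <= quasi_hyp_const d.
Proof.
move=> d2 H; apply: le_inf_subset; first exact: has_lbound_quasi_hyp.
  by exists 2; split=> //; exists 0.
move=> mu [mu0 [delta [delta0 Hd]]]; split=> //.
by have [delta' ? ?] := H _ _ mu0 delta0 Hd; exists delta'.
Qed.

Lemma quadrilateral_const_le (R : realType) (S T : Type) (e : S -> S -> R)
    (d : T -> T -> R) :
  four_point_ineq d 2 0 ->
  (forall mu, 0 <= mu -> four_point_ineq d mu 0 -> four_point_ineq e mu 0) ->
  quadrilateral_const e <= quadrilateral_const d.
Proof.
move=> d2 H; apply: le_inf_subset; first exact: has_lbound_quadrilateral.
  by exists 2; split.
by move=> mu [mu0 Hd]; split=> //; exact: H.
Qed.

Lemma consts_le_pullback (R : realType) (S T : Type) (e : S -> S -> R)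
    (d : T -> T -> R) (f : S -> T) (lambda : R) :
  0 < lambda -> (forall x y, d (f x) (f y) = lambda * e x y) ->
  four_point_ineq d 2 0 ->
  quasi_hyp_const e <= quasi_hyp_const d /\
  quadrilateral_const e <= quadrilateral_const d.
Proof.
move=> l0 df d2; split.
  apply: quasi_hyp_const_le => // mu delta mu0 delta0 H.
  exists (delta / lambda); first by rewrite divr_ge0// ltW.
  exact: four_point_ineq_pullback H.
apply: quadrilateral_const_le => // mu mu0 H.
by rewrite -(mul0r lambda^-1); exact: four_point_ineq_pullback H.
Qed.

Lemma consts_subspace_le (R : realType) (X : metricType R) (A : set X) :
  quasi_hyp_const (@subspace_dist R X A) <= quasi_hyp_const (@mdist R X) /\
  quadrilateral_const (@subspace_dist R X A) <=
    quadrilateral_const (@mdist R X).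
Proof.
apply: (@consts_le_pullback _ _ _ _ _ (fun a : A => val a) 1) => //.
  by move=> x y; rewrite mul1r.
exact: four_point_ineq_metric2.
Qed.

Lemma consts_scaled (R : realType) (X : metricType R) (lambda : R) :
  0 < lambda ->
  quasi_hyp_const (@scaled_dist R X lambda) = quasi_hyp_const (@mdist R X) /\
  quadrilateral_const (@scaled_dist R X lambda) =
    quadrilateral_const (@mdist R X).
Proof.
move=> l0; have lN0 : lambda != 0 by rewrite gt_eqF.
have li0 : 0 < lambda^-1 by rewrite invr_gt0.
have unscale (x y : X) : mdist x y = lambda^-1 * scaled_dist lambda x y.
  by rewrite /scaled_dist mulKf.
have s2 : four_point_ineq (@scaled_dist R X lambda) 2 0.
  rewrite -(mul0r (lambda^-1)^-1).
  by apply: (four_point_ineq_pullback (f := id) li0 unscale);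
     exact: four_point_ineq_metric2.
have [Cle C0le] := consts_le_pullback (f := id) li0 unscale
  (@four_point_ineq_metric2 _ X).
have [Cge C0ge] := consts_le_pullback (f := id) (e := @mdist R X) l0
  (fun _ _ => erefl) s2.
by split; apply/le_anti/andP.
Qed.

Lemma quasi_hyp_const_le_quadrilateral (R : realType) (X : metricType R) :
  quasi_hyp_const (@mdist R X) <= quadrilateral_const (@mdist R X).
Proof.
apply: le_inf_subset; first exact: has_lbound_quasi_hyp.
  by exists 2; split=> //; exact: four_point_ineq_metric2.
by move=> mu [mu0 H]; split=> //; exists 0.
Qed.

Lemma quadrilateral_const_le2 (R : realType) (X : metricType R) :
  quadrilateral_const (@mdist R X) <= 2.
Proof.
apply: ge_inf; first exact: has_lbound_quadrilateral.
by split=> //; exact: four_point_ineq_metric2.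
Qed.

Lemma quasi_hyp_const_ge1 (R : realType) (X : metricType R) :
  ~ bounded_space X -> 1 <= quasi_hyp_const (@mdist R X).
Proof.
move=> unbdd; apply: lb_le_inf.
  by exists 2; split=> //; exists 0; split=> //; exact: four_point_ineq_metric2.
move=> mu [mu0 [delta [_ H]]]; rewrite leNgt; apply/negP => mu1.
apply: unbdd; exists (delta / (1 - mu)) => x y.
by rewrite ler_pdivlMr ?subr_gt0// mulrC; exact: four_point_ineq_dist.
Qed.

Lemma quasi_hyp_const_bounded (R : realType) (X : metricType R) :
  bounded_space X -> quasi_hyp_const (@mdist R X) = 0.
Proof.
move=> [M HM].
have zero_mem : 0 <= 0 :> R /\
    exists delta, 0 <= delta /\ four_point_ineq (@mdist R X) 0 delta.
  (* The bound [M] may be negative when [X] is empty. *)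
  split=> //; exists (Num.max M 0); split; first by rewrite le_max lexx orbT.
  move=> x y z w; rewrite mul0r add0r.
  have hM : M <= Num.max M 0 by rewrite le_max lexx.
  by have := HM x y; have := HM z w; lra.
apply/le_anti/andP; split.
  by apply: ge_inf; first exact: has_lbound_quasi_hyp.
by apply: lb_le_inf; [exists 0 | move=> mu []].
Qed.

Lemma quadrilateral_const_ge1 (R : realType) (X : metricType R) :
  (exists x y : X, x <> y) -> 1 <= quadrilateral_const (@mdist R X).
Proof.
move=> [x [y xy]]; apply: lb_le_inf.
  by exists 2; split=> //; exact: four_point_ineq_metric2.
move=> mu [mu0 H]; have := four_point_ineq_dist H x y.
by rewrite pmulr_lle0 ?subr_le0// mdist_gt0; apply/eqP.
Qed.

Lemma consts_completion (R : realType) (X X' : metricType R) (iota : X -> X') :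
  is_completion iota ->
  quasi_hyp_const (@mdist R X) = quasi_hyp_const (@mdist R X') /\
  quadrilateral_const (@mdist R X) = quadrilateral_const (@mdist R X').
Proof.
move=> [_ iso dns].
have iso1 (x y : X) : mdist (iota x) (iota y) = 1 * mdist x y.
  by rewrite mul1r.
have [Cle C0le] := consts_le_pullback ltr01 iso1
  (@four_point_ineq_metric2 _ X').
have m2 := @four_point_ineq_metric2 _ X.
split; apply/le_anti/andP; split=> //.
  apply: quasi_hyp_const_le => // mu delta mu0 delta0 H.
  by exists delta => //; exact: four_point_ineq_dense H.
apply: quadrilateral_const_le => // mu mu0 H.
exact: four_point_ineq_dense H.
Qed.

Theorem proposition2p5 (R : realType) (X : metricType R) :
  (forall A : set X,
     quasi_hyp_const (@subspace_dist R X A) <= quasi_hyp_const (@mdist R X) /\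
     quadrilateral_const (@subspace_dist R X A) <=
       quadrilateral_const (@mdist R X)) /\
  (forall lambda : R, 0 < lambda ->
     quasi_hyp_const (@scaled_dist R X lambda) = quasi_hyp_const (@mdist R X) /\
     quadrilateral_const (@scaled_dist R X lambda) =
       quadrilateral_const (@mdist R X)) /\
  (quasi_hyp_const (@mdist R X) <= quadrilateral_const (@mdist R X) /\
   quadrilateral_const (@mdist R X) <= 2) /\
  (~ bounded_space X -> 1 <= quasi_hyp_const (@mdist R X)) /\
  (bounded_space X -> quasi_hyp_const (@mdist R X) = 0) /\
  ((exists x y : X, x <> y) -> 1 <= quadrilateral_const (@mdist R X)) /\
  (forall (X' : metricType R) (iota : X -> X'), is_completion iota ->
     quasi_hyp_const (@mdist R X) = quasi_hyp_const (@mdist R X') /\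
     quadrilateral_const (@mdist R X) = quadrilateral_const (@mdist R X')).
Proof.
split; first exact: consts_subspace_le.
split; first exact: consts_scaled.
split.
  split; first exact: quasi_hyp_const_le_quadrilateral.
  exact: quadrilateral_const_le2.
split; first exact: quasi_hyp_const_ge1.
split; first exact: quasi_hyp_const_bounded.
split; first exact: quadrilateral_const_ge1.
by move=> X' iota; exact: consts_completion.
Qed.
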